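(* Let $d\ge 4$. The symplectic group $\mathrm{Sp}(2d,2)$, in either one of its two doubly transitive actions of degree $2^{2d-1}\pm 2^{d-1}$ (that is, its actions on $\Omega_+$ and on $\Omega_-$), has no sharply $2$-transitive subset.
   Context: Let $V$ be a $2d$-dimensional vector space over $\mathbb{F}_2$ with a symplectic (alternating, bilinear, non-degenerate) form $\varphi$, and $\mathrm{Sp}(2d,2)=\mathrm{Sp}(V,\varphi)$ the group of linear automorphisms of $V$ preserving $\varphi$. Let $\Omega$ be the set of quadratic forms $\theta:V\to\mathbb{F}_2$ which polarize to $\varphi$, i.e. $\theta(u+v)=\theta(u)+\theta(v)+\varphi(u,v)$ for all $u,v\in V$. $\mathrm{Sp}(V,\varphi)$ acts on $\Omega$ via $\theta^g(v)=\theta(v^{g^{-1}})$. Let $\Omega_+$ denote the set of forms in $\Omega$ of Witt index $d$ and $\Omega_-$ the set of those of Witt index $d-1$; then $\Omega=\Omega_+\cup\Omega_-$, both sets are invariant under $\mathrm{Sp}(V,\varphi)$, which acts doubly transitively on each, and $|\Omega_\pm|=2^{2d-1}\pm2^{d-1}$. These are the two doubly transitive actions referred to. A set $S$ of permutations of a finite set $X$ is sharply $2$-transitive on $X$ if for any two pairs $(\alpha_1,\alpha_2),(\beta_1,\beta_2)\in X^2$ with $\alpha_1\neq\alpha_2$ and $\beta_1\ne\beta_2$ there is a unique $g\in S$ with $\alpha_1^g=\beta_1$ and $\alpha_2^g=\beta_2$. *)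

(* Defs.v *)
From mathcomp Require Import all_boot all_order all_fingroup all_algebra.
From mathcomp Require Import finfield.

Set Implicit Arguments.
Unset Strict Implicit.
Unset Printing Implicit Defensive.

Import GRing.Theory.
Local Open Scope ring_scope.

Definition sharply_2transitive (X : finType) (S : {set {perm X}}) : Prop :=
  forall a1 a2 b1 b2 : X, a1 != a2 -> b1 != b2 ->
    exists! g : {perm X}, [/\ g \in S, g a1 = b1 & g a2 = b2].

Section Symplectic.

Variable V : vectType 'F_2.
(* V itself carries no finType structure; its alias fV does. *)
Local Notation fV := (finvect_type V).
Implicit Type theta : {ffun fV -> 'F_2}.

Variable phi : {skew_symmetric V}.

Definition Sp : {set {perm fV}} :=
  [set g : {perm fV} |
    [forall a : 'F_2, forall u : fV, forall v : fV,
       g (a *: u + v) == a *: g u + g v]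
    && [forall u : fV, forall v : fV, phi (g u) (g v) == phi u v]].

Lemma Sp_group_set : group_set Sp.
Proof.
apply/group_setP; split=> [|g h].
  rewrite inE; apply/andP; split.
    by apply/'forall_'forall_forallP => a u v; rewrite !perm1.
  by apply/'forall_forallP => u v; rewrite !perm1.
rewrite !inE => /andP[/'forall_'forall_'forall_eqP lg /'forall_'forall_eqP pg].
move=> /andP[/'forall_'forall_'forall_eqP lh /'forall_'forall_eqP ph].
apply/andP; split.
  by apply/'forall_'forall_'forall_eqP => a u v; rewrite !permM lg lh.
by apply/'forall_'forall_eqP => u v; rewrite !permM ph pg.
Qed.
Canonical Sp_group : {group {perm fV}} := group Sp_group_set.

Definition Omega : {set {ffun fV -> 'F_2}} :=
  [set theta : {ffun fV -> 'F_2} |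
    [forall a : 'F_2, forall v : fV, theta (a *: v) == a ^+ 2 * theta v]
    && [forall u : fV, forall v : fV,
          theta (u + v) == theta u + theta v + phi u v]].

Definition totally_singular theta (U : {vspace fV}) : bool :=
  [forall v : fV, (v \in U) ==> (theta v == 0)].

(* The maximal dimension of a totally singular subspace. {vspace V} is not a
   finType, so subspaces are enumerated as spans of subsets of V. *)
Definition witt_index theta : nat :=
  (\max_(B : {set fV} | totally_singular theta <<enum B>>) \dim <<enum B>>)%N.

Lemma witt_index_max theta (U : {vspace fV}) :
  totally_singular theta U -> (\dim U <= witt_index theta)%N.
Proof.
move=> sU; pose B := [set v : fV | v \in U].
have eBU : <<enum B>>%VS = U.
  apply/eqP; rewrite eqEsubv; apply/andP; split.
    by apply/span_subvP => v; rewrite mem_enum inE.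
  by apply/subvP => v vU; apply: memv_span; rewrite mem_enum inE.
by rewrite -{1}eBU; apply: leq_bigmax_cond; rewrite eBU.
Qed.

Definition qform_act theta (g : {perm fV}) : {ffun fV -> 'F_2} :=
  [ffun v => theta ((g^-1)%g v)].

Lemma qform_act_is_action : is_action setT qform_act.
Proof.
apply: is_total_action => [theta | theta g h]; apply/ffunP => v.
  by rewrite ffunE invg1 perm1.
by rewrite !ffunE invMg permM.
Qed.
Canonical qform_action := Action qform_act_is_action.

(* The group of permutations that Sp induces on a set X of forms. *)
Definition Sp_on (X : {set {ffun fV -> 'F_2}}) :
    {set {perm {theta | theta \in X}}} :=
  [set s : {perm {theta | theta \in X}} |
    [exists g in Sp, forall theta, val (s theta) == qform_action (val theta) g]].

End Symplectic.

Definition Omega_plus (d : nat) (V : vectType 'F_2) (phi : {skew_symmetric V}) :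
    {set {ffun finvect_type V -> 'F_2}} :=
  [set theta in Omega phi | witt_index theta == d].

Definition Omega_minus (d : nat) (V : vectType 'F_2)
    (phi : {skew_symmetric V}) : {set {ffun finvect_type V -> 'F_2}} :=
  [set theta in Omega phi | witt_index theta == d.-1].

(* Main.v *)
Require Import Defs.
From HB Require Import structures.
From mathcomp Require Import all_boot all_order all_fingroup all_algebra.
From mathcomp Require Import finfield zify ring.

Set Implicit Arguments.
Unset Strict Implicit.
Unset Printing Implicit Defensive.

Import GRing.Theory Num.Theory.
Local Open Scope ring_scope.

(** Write X for the set of forms of the given Witt index (d or d - 1) that
    polarize to phi, and suppose that S is sharply 2-transitive on X. Fix theta
    in X. Every form polarizing to phi is theta + phi(a, -) for a unique vector
    a, and it lies in X exactly when theta(a) = 0 (lemma [shift_witt_class]); so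
    X minus theta is identified with the nonzero singular vectors of theta. The
    elements of S fixing theta then come from isometries g of theta and form a
    set S0 which is sharply transitive on these vectors. As |X| is even, |S0| is
    odd. The contradiction is a parity count of pairs: a set A of 64 vectors and
    a function h with values in 'F_2 are found such that

    - A avoids 0 and contains an even number of singular vectors;
    - for every g in Sp, the sum of h(g v) over the singular v in A is 1.

    Summing the second property over S0 gives |S0| = 1 in 'F_2. Exchanging the
    sums, each singular v of A contributes the total sum of h over the nonzero
    singular vectors, since S0 is sharply transitive; as there is an even number
    of such v, the result is 0.

    Both properties follow from the fact that a function of degree less than n
    sums to zero over an n-dimensional cube ([sum_cube_deg_lt]). Take a
    symplectic basis e_1, f_1, ..., e_d, f_d, and put q_i(v) = phi(v, e_i)
    phi(v, f_i). Let A be the translate by e_4 of the span of e_1, f_1, e_2,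
    f_2, e_3, f_3: a 6-dimensional cube which avoids 0; this is where d >= 4
    enters. The indicator 1 + theta of singularity has degree 2, whence
    the first property. Let h be the second elementary symmetric function of the
    q_i ([std_quartic]). Its fourth derivative is the pfaffian of phi
    ([diff4_std_quartic]), which Sp preserves, so h(g v) - h(v) has degree at
    most 3, and its product with 1 + theta, of degree at most 5, sums to 0 over
    A. Likewise theta may be replaced by the sum of the q_i, which differs from
    it by a function of degree at most 1. What remains is one explicit sum
    ([standard_count]), independent of theta and g.

    The statements on X come from the Gauss sum of theta, the sum of
    (-1)^theta(v): computed along a totally singular subspace of maximal
    dimension, it is 2^d or -2^d according to the Witt index, and it is
    multiplied by (-1)^theta(a) when theta is replaced by theta + phi(a, -).
    This gives the parity of |X| and shows that theta(a) = 0 is necessary for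
    theta + phi(a, -) to be in X; for sufficiency, if theta(a) = 0, then
    theta + phi(a, -) is the image of theta under the transvection of
    direction a. *)

Lemma addF2 (x : 'F_2) : x + x = 0.
Proof. by apply: addrr_pchar2; apply: pchar_Fp. Qed.

Lemma oppF2 (x : 'F_2) : - x = x.
Proof. by apply: oppr_pchar2; apply: pchar_Fp. Qed.

Lemma neq0_F2 (x : 'F_2) : (x != 0) = (x == 1).
Proof. by case: x => [[|[|]]]. Qed.

Lemma F2_eq01 (x : 'F_2) : x = 0 \/ x = 1.
Proof. by have := neq0_F2 x; case: eqP => [|_ /esym/eqP]; [left | right]. Qed.

(** * Polynomial functions and sums over cubes *)

Section Differences.

Variable V : zmodType.
Implicit Types (F G : V -> 'F_2) (u v w : V) (ws : seq V).

Definition diff w F v := F (v + w) - F v.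

(** The degree of a function is defined through its iterated differences, which
    spares the choice of coordinates; [deg_lt n F] means that F has degree less
    than n, so that [deg_lt 0 F] says that F vanishes. *)
Fixpoint deg_lt n F : Prop :=
  if n is n'.+1 then forall w, deg_lt n' (diff w F) else F =1 (fun=> 0).

Lemma eq_deg_lt n F G : F =1 G -> deg_lt n F -> deg_lt n G.
Proof.
elim: n F G => [|n IHn] F G eqFG /=; first by move=> F0 v; rewrite -eqFG.
by move=> dF w; apply: IHn (dF w) => v; rewrite /diff !eqFG.
Qed.

Lemma deg_lt0 n : deg_lt n (fun=> 0).
Proof.
elim: n => [|n IHn] //= w.
by apply: eq_deg_lt IHn => v; rewrite /diff subrr.
Qed.

Lemma deg_lt_leq m n F : (m <= n)%N -> deg_lt m F -> deg_lt n F.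
Proof.
elim: m n F => [|m IHm] [|n] F //= le_mn dF; last by move=> w; apply: IHm.
by apply: (@eq_deg_lt n.+1 _ _ _ (deg_lt0 n.+1)) => v; rewrite dF.
Qed.

Lemma deg_ltD n F G : deg_lt n F -> deg_lt n G -> deg_lt n (fun v => F v + G v).
Proof.
elim: n F G => [|n IHn] F G /= dF dG; first by move=> v; rewrite dF dG addr0.
move=> w; apply: eq_deg_lt (IHn _ _ (dF w) (dG w)) => v.
by rewrite /diff; ring.
Qed.

Lemma deg_lt_shift n w F : deg_lt n F -> deg_lt n (fun v => F (v + w)).
Proof.
elim: n F => [|n IHn] F /= dF; first by move=> v; rewrite dF.
move=> w'; apply: eq_deg_lt (IHn _ (dF w')) => v.
by rewrite /diff addrAC.
Qed.

(** Degrees are at most additive, by the twisted Leibniz rule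
    D(FG)(v) = DF(v) G(v + w) + F(v) DG(v). *)
Lemma deg_ltM m n F G :
  deg_lt m F -> deg_lt n G -> deg_lt (m + n).-1 (fun v => F v * G v).
Proof.
have [k] := ubnP (m + n); elim: k m n F G => // k IHk [|m] [|n] F G le_k dF dG.
- by apply: eq_deg_lt (deg_lt0 _) => v; rewrite dF mul0r.
- by apply: eq_deg_lt (deg_lt0 _) => v; rewrite dF mul0r.
- by apply: eq_deg_lt (deg_lt0 _) => v; rewrite dG mulr0.
rewrite addnS /= => w; rewrite addSn addnS !ltnS in le_k.
have dl : deg_lt (m + n) (fun v => diff w F v * G (v + w)).
  rewrite -[X in deg_lt X _]/(m + n).+1.-1 -addnS.
  by apply: IHk (dF w) (deg_lt_shift w dG); rewrite addnS.
have dr : deg_lt (m + n) (fun v => F v * diff w G v).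
  rewrite -[X in deg_lt X _]/(m.+1 + n).-1.
  by apply: IHk dF (dG w); rewrite addSn.
by apply: eq_deg_lt (deg_ltD dl dr) => v; rewrite /diff; ring.
Qed.

(** A list rather than a set: it keeps multiplicities when ws is dependent, so
    that a sum over a cube is always an iterated difference. *)
Fixpoint cube u ws : seq V :=
  if ws is w :: ws' then cube u ws' ++ [seq v + w | v <- cube u ws']
  else [:: u].

(** In characteristic 2, the sum of F over the cube spanned by ws from u is the
    value at u of the iterated difference of F along ws. *)
Lemma sum_cube_deg_lt u ws F :
  deg_lt (size ws) F -> \sum_(v <- cube u ws) F v = 0.
Proof.
elim: ws F => [|w ws IHws] F /= dF; first by rewrite big_seq1 dF.
rewrite big_cat big_map /= -big_split /= -[RHS](IHws _ (dF w)).
by apply: eq_bigr => v _; rewrite /diff oppF2 addrC.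
Qed.

Lemma cube_const (l : V -> 'F_2) u ws :
    {morph l : v w / v + w} -> {in ws, forall w, l w = 0} ->
  {in cube u ws, forall v, l v = l u}.
Proof.
move=> lD; elim: ws => [|w ws IHws] l0 v /=.
  by rewrite inE => /eqP->.
have {}IHws : {in cube u ws, forall v', l v' = l u}.
  by apply: IHws => w' w'ws; apply: l0; rewrite inE w'ws orbT.
rewrite mem_cat => /orP[/IHws // | /mapP[v' v'c ->]].
by rewrite lD IHws // (l0 w) ?mem_head // addr0.
Qed.

End Differences.

Lemma map_cube (V W : zmodType) (l : V -> W) u ws :
  {morph l : v w / v + w} -> map l (cube u ws) = cube (l u) (map l ws).
Proof.
move=> lD; elim: ws => [|w ws IHws] //=; rewrite map_cat IHws; congr (_ ++ _).
by rewrite -IHws -!map_comp; apply: eq_map => v /=; rewrite lD.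
Qed.

(** * The standard quadratic and quartic functions *)

Section Quadratic.

Variables (V : zmodType) (phi : V -> V -> 'F_2).
Hypothesis phiDl : forall u v w, phi (u + v) w = phi u w + phi v w.
Hypothesis phiC : forall u v, phi u v = phi v u.
Hypothesis phiuu : forall u, phi u u = 0.

Definition polarizes_to (theta : V -> 'F_2) (b : V -> V -> 'F_2) :=
  forall u v, theta (u + v) = theta u + theta v + b u v.

Lemma polarizes_deg_lt theta : polarizes_to theta phi -> deg_lt 3 theta.
Proof.
by move=> th /= a b c v; rewrite /diff !th !phiDl; ring.
Qed.

Lemma deg_lt_sub_polarizes theta1 theta2 :
    polarizes_to theta1 phi -> polarizes_to theta2 phi ->
  deg_lt 2 (fun v => theta1 v - theta2 v).
Proof. by move=> th1 th2 /= a b v; rewrite /diff !th1 !th2 !phiDl; ring. Qed.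

Implicit Types (p : V * V) (s : seq (V * V)).

Definition hyp_form p v := phi v p.1 * phi v p.2.
Definition hyp_polar p a b := phi a p.1 * phi b p.2 + phi a p.2 * phi b p.1.
Definition std_form s v := \sum_(p <- s) hyp_form p v.
Definition std_polar s a b := \sum_(p <- s) hyp_polar p a b.

Lemma std_form_polarizes s : polarizes_to (std_form s) (std_polar s).
Proof.
move=> u v; rewrite /std_form /std_polar -!big_split /=.
by apply: eq_bigr => p _; rewrite /hyp_form /hyp_polar !phiDl; ring.
Qed.

Lemma std_polarDl s u v w :
  std_polar s (u + v) w = std_polar s u w + std_polar s v w.
Proof.
rewrite /std_polar -!big_split /=.
by apply: eq_bigr => p _; rewrite /hyp_polar !phiDl; ring.
Qed.

(** The second elementary symmetric function of the hyperbolic forms of s: its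
    leading form is the divided square of [std_polar s]. *)
Fixpoint std_quartic s v :=
  if s is p :: s' then std_quartic s' v + hyp_form p v * std_form s' v else 0.

Definition pfaffian (b : V -> V -> 'F_2) (x y z t : V) :=
  b x y * b z t + b x z * b y t + b x t * b y z.

(** The pfaffian is the divided square of an alternating form b. When a
    hyperbolic form q joins s, the new term q * std_form s contributes the
    polarized products of [hyp_polar] and [std_polar s], which are exactly the
    cross terms of the pfaffian of their sum; the pfaffian of [hyp_polar] alone
    vanishes since this form has rank 2. *)
Lemma diff4_std_quartic s x y z t v :
  diff x (diff y (diff z (diff t (std_quartic s)))) v
    = pfaffian (std_polar s) x y z t.
Proof.
elim: s => [|p s IHs].
  by rewrite /pfaffian /std_polar !big_nil /diff /= !subrr !mulr0 !addr0.
have polE a b : std_polar (p :: s) a b = hyp_polar p a b + std_polar s a b.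
  by rewrite /std_polar big_cons.
(* Over the integers, each of the six monomials would occur twice. *)
have hyp0 : pfaffian (hyp_polar p) x y z t = 0.
  rewrite -[RHS](addF2 (phi x p.1 * phi y p.1 * phi z p.2 * phi t p.2
    + phi x p.1 * phi z p.1 * phi y p.2 * phi t p.2
    + phi x p.1 * phi t p.1 * phi y p.2 * phi z p.2
    + phi y p.1 * phi z p.1 * phi x p.2 * phi t p.2
    + phi y p.1 * phi t p.1 * phi x p.2 * phi z p.2
    + phi z p.1 * phi t p.1 * phi x p.2 * phi y p.2)).
  by rewrite /pfaffian /hyp_polar; ring.
have -> : pfaffian (std_polar (p :: s)) x y z t =
    pfaffian (std_polar s) x y z t + pfaffian (hyp_polar p) x y z t +
    (hyp_polar p x y * std_polar s z t + hyp_polar p z t * std_polar s x y +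
    (hyp_polar p x z * std_polar s y t + hyp_polar p y t * std_polar s x z) +
    (hyp_polar p x t * std_polar s y z + hyp_polar p y z * std_polar s x t)).
  by rewrite /pfaffian !polE; ring.
rewrite hyp0 addr0 -IHs /diff /=.
rewrite !(std_form_polarizes s _ _) !std_polarDl.
rewrite /hyp_form /hyp_polar !phiDl; ring.
Qed.


Definition hyperbolic p := phi p.1 p.2 == 1.
Definition orth_pair p p' :=
  [&& phi p.1 p'.1 == 0, phi p.1 p'.2 == 0,
      phi p.2 p'.1 == 0 & phi p.2 p'.2 == 0].
Definition symplectic_seq s := all hyperbolic s && pairwise orth_pair s.

Definition pair_seq s : seq V := flatten [seq [:: p.1; p.2] | p <- s].

Lemma std_form_eq0 s v :
  {in pair_seq s, forall w, phi v w = 0} -> std_form s v = 0.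
Proof.
move=> v0; rewrite /std_form big_seq big1 // => p ps.
rewrite /hyp_form v0 ?mul0r //; apply/flatten_mapP; exists p => //.
exact: mem_head.
Qed.

Lemma std_quartic_eq0 s v :
  {in pair_seq s, forall w, phi v w = 0} -> std_quartic s v = 0.
Proof.
elim: s => //= p s IHs v0; rewrite IHs ?std_form_eq0 ?mulr0 ?addr0 // => w ws;
  by apply: v0; rewrite !inE ws !orbT.
Qed.

Lemma mem_pair_seq s w : reflect
  (exists2 p, p \in s & w = p.1 \/ w = p.2) (w \in pair_seq s).
Proof.
apply: (iffP flatten_mapP) => -[p ps]; exists p => //.
  by move: q; rewrite !inE => /orP[] /eqP->; [left | right].
by rewrite !inE; case: q => ->; rewrite eqxx ?orbT.
Qed.

(** ** The count on the cube *)

Section StandardCount.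

Variables (p1 p2 p3 p4 : V * V) (s : seq (V * V)).
Let ps := [:: p1, p2, p3, p4 & s].
Let ws := pair_seq [:: p1; p2; p3].
Hypothesis ps_symp : symplectic_seq ps.
Hypothesis ps_full : std_polar ps =2 phi.


Lemma hyperbolicP p : hyperbolic p -> (phi p.1 p.2 = 1) * (phi p.2 p.1 = 1).
Proof. by move=> /eqP h; rewrite [phi p.2 _]phiC. Qed.

Lemma orth_pairP p p' : orth_pair p p' ->
  (phi p.1 p'.1 = 0) * (phi p.1 p'.2 = 0) * (phi p.2 p'.1 = 0) *
  (phi p.2 p'.2 = 0) * (phi p'.1 p.1 = 0) * (phi p'.2 p.1 = 0) *
  (phi p'.1 p.2 = 0) * (phi p'.2 p.2 = 0).
Proof.
case/and4P=> /eqP o1 /eqP o2 /eqP o3 /eqP o4.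
by rewrite (phiC p'.1) (phiC p'.2) (phiC p'.1) (phiC p'.2).
Qed.

(** This keeps 0 out of the cube. *)
Lemma cube_pairing_last : {in cube p4.1 ws, forall v, phi v p4.2 = 1}.
Proof.
move=> v vc; have [hs os] := andP ps_symp; rewrite /= in hs os.
case/and5P: hs => _ _ _ /hyperbolicP h4 _.
case/and4P: os => /and4P[_ _ /orth_pairP o14 _] /and3P[_ /orth_pairP o24 _].
case/andP=> /orth_pairP o34 _ _.
rewrite (cube_const (l := phi^~ p4.2) (fun v w => phiDl v w _) _ vc) //.
  by rewrite h4.
move=> w.
by rewrite !inE => /or4P[|||/orP[|/orP[]]] /eqP->; rewrite ?o14 ?o24 ?o34.
Qed.

Let coords v := (phi v p1.1, phi v p1.2, (phi v p2.1, phi v p2.2),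
                 (phi v p3.1, phi v p3.2)).

(** On the cube the hyperbolic forms other than the first three vanish, so both
    factors depend only on the six coordinates [coords v], which run through all
    of 'F_2^6. With t_i = x_i y_i, the summand is 1 exactly when two of the
    three t_i are 1, that is, for 3 * 3 choices of the coordinates. *)
Lemma standard_count :
  \sum_(v <- cube p4.1 ws) (1 + std_form ps v) * std_quartic ps v = 1.
Proof.
have [hs os] := andP ps_symp; rewrite /= in hs os.
case/and5P: hs => [/hyperbolicP h1 /hyperbolicP h2 /hyperbolicP h3 _ _].
case/and5P: os.
case/and4P=> /orth_pairP o12 /orth_pairP o13 /orth_pairP o14 /allP o1s.
move=> /and3P[/orth_pairP o23 /orth_pairP o24 /allP o2s].
move=> /andP[/orth_pairP o34 /allP o3s] /allP o4s _.
pose C6 : zmodType := ('F_2 * 'F_2 * ('F_2 * 'F_2) * ('F_2 * 'F_2))%type.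
pose t1 (c : C6) := c.1.1.1 * c.1.1.2.
pose t2 (c : C6) := c.1.2.1 * c.1.2.2.
pose t3 (c : C6) := c.2.1 * c.2.2.
pose G c := (1 + (t1 c + t2 c + t3 c)) * (t3 c * t2 c + t1 c * (t2 c + t3 c)).
transitivity (\sum_(c <- [seq coords v | v <- cube p4.1 ws]) G c).
  rewrite big_map big_seq [RHS]big_seq; apply: eq_bigr => v vc.
  have v4 : hyp_form p4 v = 0.
    rewrite /hyp_form.
    rewrite (cube_const (l := phi^~ p4.1) (fun v w => phiDl v w _) _ vc) //.
      by rewrite phiuu mul0r.
    by move=> w; rewrite !inE => /or4P[|||/orP[|/orP[]]] /eqP->;
      rewrite ?o14 ?o24 ?o34.
  have vs : {in pair_seq s, forall w, phi v w = 0}.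
    move=> w /mem_pair_seq[p ps' wp].
    move: (o1s p ps') (o2s p ps') (o3s p ps') (o4s p ps').
    move=> /orth_pairP o1p /orth_pairP o2p /orth_pairP o3p /orth_pairP o4p.
    rewrite (cube_const (l := phi^~ w) (fun v w => phiDl v w _) _ vc) //.
      by case: wp => ->; rewrite o4p.
    by move=> w'; rewrite !inE => /or4P[|||/orP[|/orP[]]] /eqP->;
      case: wp => ->; rewrite ?o1p ?o2p ?o3p.
  rewrite /= /std_form !big_cons -!/(std_form _ _) v4 (std_form_eq0 vs).
  rewrite (std_quartic_eq0 vs) /G /t1 /t2 /t3 /coords /= /hyp_form; ring.
have cD : {morph coords : v w / v + w} by move=> v w; rewrite /coords !phiDl.
rewrite (map_cube _ _ cD).
have -> : coords p4.1 = 0 by rewrite /coords !(o14, o24, o34).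
pose x1 : C6 := (1, 0, 0, 0).
pose y1 : C6 := (0, 1, 0, 0).
pose x2 : C6 := (0, (1, 0), 0).
pose y2 : C6 := (0, (0, 1), 0).
pose x3 : C6 := (0, (1, 0)).
pose y3 : C6 := (0, (0, 1)).
have -> : map coords ws = [:: y1; x1; y2; x2; y3; x3].
  by rewrite /= /coords !(phiuu, h1, h2, h3, o12, o13, o23).
by apply/eqP; rewrite unlock; vm_compute.
Qed.

Lemma deg_lt_std_quartic : deg_lt 5 (std_quartic ps).
Proof.
by move=> a b c d e v; rewrite {1}/diff !diff4_std_quartic subrr.
Qed.

(** The fourth derivative of the quartic function is the pfaffian of phi, hence
    invariant under isometries of phi. *)
Lemma deg_lt_std_quartic_isometry (g : V -> V) :
    {morph g : u v / u + v} -> (forall u v, phi (g u) (g v) = phi u v) ->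
  deg_lt 4 (fun v => std_quartic ps (g v) - std_quartic ps v).
Proof.
move=> gD gphi d c b a v.
transitivity (
  diff (g a) (diff (g b) (diff (g c) (diff (g d) (std_quartic ps)))) (g v)
  - diff a (diff b (diff c (diff d (std_quartic ps)))) v).
  by move: (std_quartic ps) => F; rewrite /diff /= !gD; ring.
by rewrite !diff4_std_quartic /pfaffian !ps_full !gphi subrr.
Qed.

Lemma deg_lt_1D theta :
  polarizes_to theta phi -> deg_lt 3 (fun v => 1 + theta v).
Proof.
move=> th; apply: deg_ltD (polarizes_deg_lt th) => a b c v.
by rewrite /diff; ring.
Qed.

(** The sum over the singular vectors of the cube: 1 + theta is the indicator of
    singularity. Up to terms of degree less than 6, g can be replaced by the
    identity and theta by the standard form. *)
Lemma isometry_count theta (g : V -> V) :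
    polarizes_to theta phi ->
    {morph g : u v / u + v} -> (forall u v, phi (g u) (g v) = phi u v) ->
  \sum_(v <- cube p4.1 ws) (1 + theta v) * std_quartic ps (g v) = 1.
Proof.
move=> th gD gphi; rewrite -[RHS]standard_count.
have dth := deg_lt_1D th.
have stdth : polarizes_to (std_form ps) phi.
  by move=> u v; rewrite std_form_polarizes ps_full.
apply/eqP; rewrite -subr_eq0 -sumrB; apply/eqP.
rewrite (eq_bigr (fun v =>
  (1 + theta v) * (std_quartic ps (g v) - std_quartic ps v) +
  (theta v - std_form ps v) * std_quartic ps v)); last first.
  move=> v _; move: (std_quartic ps) (std_form ps) => Q q /=; ring.
rewrite big_split /=.
rewrite (@sum_cube_deg_lt _ _ ws _
  (deg_ltM dth (deg_lt_std_quartic_isometry gD gphi))).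
rewrite (@sum_cube_deg_lt _ _ ws _
  (deg_ltM (deg_lt_sub_polarizes th stdth) deg_lt_std_quartic)).
by rewrite addr0.
Qed.

Lemma even_count theta : polarizes_to theta phi ->
  \sum_(v <- cube p4.1 ws) (1 + theta v) = 0.
Proof.
move=> /deg_lt_1D dth; apply/sum_cube_deg_lt.
exact: deg_lt_leq dth.
Qed.

End StandardCount.
End Quadratic.

(** * Stabilizers in a sharply 2-transitive set *)

(** For each y other than x0, exactly one element of S fixes x0 and sends x
    to y. *)
Lemma sum_sharply_2transitive (X : finType) (S : {set {perm X}}) (x0 x : X)
    (K : X -> 'F_2) :
    sharply_2transitive S -> x != x0 ->
  \sum_(s in S | s x0 == x0) K (s x) = \sum_(y | y != x0) K y.
Proof.
move=> trS neq_x; rewrite (partition_big (fun s : {perm X} => s x)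
  (fun y => y != x0)) /=; last first.
  by move=> s /andP[_ /eqP s0]; rewrite -[X in _ != X]s0 (inj_eq perm_inj).
apply: eq_bigr => y neq_y.
rewrite eq_sym in neq_x; rewrite eq_sym in neq_y.
have [g [[Sg g0 gx] g_uniq]] := trS x0 x x0 y neq_x neq_y.
rewrite (big_pred1 g) ?gx // => s; apply/idP/eqP => [|->].
  by case/andP=> /andP[Ss /eqP s0 /eqP sx]; rewrite (g_uniq s).
by rewrite Sg g0 gx !eqxx.
Qed.

(** * Gauss sums of quadratic forms *)

Section SymplecticSpace.

Variables (V : vectType 'F_2) (phi : {skew_symmetric V}).
Hypothesis phi_symp : is_psymplectic phi.
Local Notation fV := (finvect_type V).
Implicit Types (u v w a : fV) (U : {vspace fV}).
Implicit Types theta : {ffun fV -> 'F_2}.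

(* The form read on the finite type fV, where vectors can be summed over. *)
Let b (u v : fV) : 'F_2 := phi u v.

Lemma bDl u v w : b (u + v) w = b u w + b v w.
Proof. exact: linearDl. Qed.

Lemma bC u v : b u v = b v u.
Proof. by rewrite /b hermC /= expr1 mulN1r oppF2. Qed.

Lemma buu u : b u u = 0.
Proof. by case: phi_symp => _ _; apply; apply: pchar_Fp. Qed.

Lemma bDr u v w : b u (v + w) = b u v + b u w.
Proof. by rewrite bC bDl !(bC u). Qed.

Lemma bZl k u v : b (k *: u) v = k * b u v.
Proof. exact: linearZl_LR. Qed.

Lemma bZr k u v : b u (k *: v) = k * b u v.
Proof. by rewrite bC bZl bC. Qed.

Lemma b0l u : b 0 u = 0.
Proof. by have := bDl 0 0 u; rewrite addr0 addF2. Qed.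

Lemma b_nondeg u : (forall v, b u v = 0) -> u = 0.
Proof.
case: phi_symp => /eqP rad0 _ _ u0; apply/eqP; rewrite -[_ == _](memv0 (u : V)).
suff: (u : V) \in orthov phi fullv by rewrite rad0.
by apply/mem_orthovP => v _; apply: u0.
Qed.

Lemma polarizes0 (theta : fV -> 'F_2) : polarizes_to theta b -> theta 0 = 0.
Proof. by move=> th; have := th 0 0; rewrite addr0 addF2 buu addr0. Qed.

Lemma OmegaP theta : reflect (polarizes_to theta b) (theta \in Omega phi).
Proof.
rewrite inE; apply: (iffP andP) => [[_ /'forall_'forall_eqP] // | th].
split; last by apply/'forall_'forall_eqP.
have th0 := polarizes0 th.
apply/'forall_'forall_eqP => k v; case: (F2_eq01 k) => ->.
  by rewrite scale0r th0 expr0n mul0r.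
by rewrite scale1r expr1n mul1r.
Qed.

Lemma Omega0 theta : theta \in Omega phi -> theta 0 = 0.
Proof. by move/OmegaP/polarizes0. Qed.

Definition chi (x : 'F_2) : int := if x == 0 then 1 else -1.

Lemma chiD x y : chi (x + y) = chi x * chi y.
Proof.
by case: (F2_eq01 x) => ->; case: (F2_eq01 y) => ->; rewrite ?add0r ?addF2.
Qed.

Definition gauss theta := \sum_v chi (theta v).

(** If l(u0) = 1 for some u0 in U, translation by u0 changes the sign of the
    sum. *)
Lemma sum_chi_linear U (l : fV -> 'F_2) : {morph l : u v / u + v} ->
  \sum_(u in U) chi (l u)
    = if [forall u in U, l u == 0] then #|U|%:R else 0.
Proof.
move=> lD; case: ifPn => [/'forall_in_eqP l0|].
  by rewrite (eq_bigr (fun=> 1)) ?sumr_const // => u /l0->.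
case/forall_inPn => u0 u0U; rewrite neq0_F2 => /eqP l1.
set r := \sum_(u in U) _.
have : r = - r.
  rewrite {1}/r (reindex_inj (addIr u0)) -sumrN.
  apply: eq_big => u; first by rewrite rpredDr.
  by move=> _; rewrite lD l1 chiD /= mulrN1.
by move/eqP; rewrite -addr_eq0 -mulr2n mulrn_eq0 => /eqP.
Qed.

Definition perp U := [set v | [forall u in U, b u v == 0]].

(** Double count of the sum of the characters (-1)^b(u, v) over u in U and all
    v. *)
Lemma card_perp U : (#|U| * #|perp U| = #|fV|)%N.
Proof.
apply/eqP; rewrite -(eqr_nat int) natrM; apply/eqP.
transitivity (\sum_v \sum_(u in U) chi (b u v)).
  rewrite (eq_bigr (fun v => if v \in perp U then #|U|%:R else 0)).
    by rewrite -big_mkcond sumr_const /= mulr_natr.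
  move=> v _; rewrite (sum_chi_linear _ (l := b^~ v)) ?inE // => u w.
  exact: bDl.
rewrite exchange_big (bigD1 0) ?mem0v //= [X in _ + X]big1 => [|u /andP[_ u0]].
  by rewrite addr0 (eq_bigr (fun=> 1)) ?sumr_const // => v _; rewrite b0l.
rewrite (eq_bigl (fun v => v \in fullv)); last by move=> v; rewrite memvf.
rewrite sum_chi_linear; last by move=> v w; apply: bDr.
case: ifP => // /'forall_in_eqP h; case/eqP: u0; apply: b_nondeg => v.
by apply: h; apply: memvf.
Qed.

(** Average the Gauss sum over translations by U: since theta(v + u) =
    theta(v) + b(u, v) for u in U, the terms with v outside the orthogonal of U
    cancel. *)
Lemma gauss_perp theta U : theta \in Omega phi -> totally_singular theta U ->
  gauss theta = \sum_(v in perp U) chi (theta v).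
Proof.
move=> /OmegaP th /'forall_implyP tsU.
have U0 : #|U|%:R != 0 :> int.
  by rewrite pnatr_eq0 -lt0n; apply/card_gt0P; exists 0; apply: mem0v.
apply: (mulfI U0).
transitivity (\sum_(u in U) \sum_v chi (theta (v + u))).
  rewrite -sumr_const mulr_suml; apply: eq_bigr => u _.
  by rewrite mul1r /gauss (reindex_inj (addIr u)).
rewrite exchange_big mulr_sumr [RHS]big_mkcond /=; apply: eq_bigr => v _.
rewrite (eq_bigr (fun u => chi (theta v) * chi (b u v))) => [|u uU].
  rewrite -mulr_sumr (sum_chi_linear _ (l := b^~ v)) => [|u w].
    by rewrite inE; case: ifP; rewrite ?mulr0 // mulrC.
  exact: bDl.
by rewrite th (eqP (tsU u uU)) addr0 chiD bC.
Qed.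


(** ** Gauss sums and the Witt index *)

Section Dimension.

Variable d : nat.
Hypothesis dimV : \dim {:V} = (2 * d)%N.

Lemma card_sub U : #|U| = (2 ^ \dim U)%N.
Proof. by rewrite card_vspace card_Fp. Qed.

Lemma card_fV : #|fV| = (2 ^ (2 * d))%N.
Proof.
rewrite -dimV -[\dim {:V}]/(\dim {:fV}) -card_sub.
by apply: eq_card => v; rewrite memvf.
Qed.

Lemma totally_singular0 theta : theta \in Omega phi ->
  totally_singular theta <<[::]>>.
Proof.
move=> th; apply/'forall_implyP => u; rewrite span_nil memv0 => /eqP->.
by rewrite (Omega0 th).
Qed.

Lemma witt_index_attained theta : theta \in Omega phi ->
  exists2 U, totally_singular theta U & \dim U = witt_index theta.
Proof.
move=> th; pose P (B : {set fV}) := totally_singular theta <<enum B>>.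
have : (0 < #|P|)%N.
  apply/card_gt0P; exists set0; rewrite unfold_in /P enum_set0.
  exact: totally_singular0 th.
case/(eq_bigmax_cond (fun B : {set fV} => \dim <<enum B>>)) => B PB eqB.
by exists <<enum B>>%VS.
Qed.

Lemma totally_singular_isotropic theta U : theta \in Omega phi ->
  totally_singular theta U -> {in U &, forall u v, b u v = 0}.
Proof.
move=> /OmegaP th /'forall_implyP tsU u v uU vU.
have := th u v.
rewrite (eqP (tsU u uU)) (eqP (tsU v vU)) (eqP (tsU _ (memvD uU vU))).
by rewrite !add0r.
Qed.

Lemma sub_perp theta U : theta \in Omega phi -> totally_singular theta U ->
  {subset U <= perp U}.
Proof.
move=> th tsU u uU; rewrite inE; apply/'forall_in_eqP => v vU.
exact: (totally_singular_isotropic th tsU).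
Qed.

Lemma card_perp_dim U : (#|perp U| * 2 ^ \dim U = 2 ^ (2 * d))%N.
Proof. by rewrite -card_fV -(card_perp U) card_sub mulnC. Qed.

Lemma dim_totally_singular theta U :
  theta \in Omega phi -> totally_singular theta U -> (\dim U <= d)%N.
Proof.
move=> th tsU; have leUP := subset_leq_card (introT subsetP (sub_perp th tsU)).
rewrite -(leq_pmul2l (isT : 0 < 2)%N) -(leq_exp2l _ _ (isT : 1 < 2)%N).
rewrite -(card_perp_dim U) mul2n -addnn expnD leq_mul2r -card_sub.
by rewrite leUP orbT.
Qed.

(** Here U is its own orthogonal, so every term of [gauss_perp] is 1. *)
Lemma gauss_dim_d theta U : theta \in Omega phi -> totally_singular theta U ->
  \dim U = d -> gauss theta = (2 ^ d)%:R.
Proof.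
move=> th tsU dimU; rewrite (gauss_perp th tsU).
have eqU : U =i perp U.
  apply/subset_cardP; last exact/subsetP/(sub_perp th).
  have := card_perp_dim U; rewrite dimU mul2n -addnn expnD => /eqP.
  by rewrite eqn_pmul2r ?expn_gt0 // card_sub dimU => /eqP.
rewrite -dimU -card_sub -(eq_bigl _ _ eqU).
rewrite (eq_bigr (fun=> 1)) ?sumr_const // => v.
by move/'forall_implyP: tsU => tsU /tsU/eqP->.
Qed.

(** The orthogonal of U consists of four cosets of U. A singular vector outside
    U in this orthogonal would extend U to a larger totally singular subspace,
    so theta is 1 on the three other cosets and the sum is |U| - 3 |U|. *)
Lemma gauss_dim_pred theta U : (0 < d)%N -> theta \in Omega phi ->
    totally_singular theta U -> \dim U = d.-1 -> witt_index theta = d.-1 ->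
  gauss theta = - (2 ^ d)%:R.
Proof.
move=> d_gt0 th tsU dimU wt; rewrite (gauss_perp th tsU).
have subU := sub_perp th tsU.
have cardU : #|U| = (2 ^ d.-1)%N by rewrite card_sub dimU.
have cardP : #|perp U| = (4 * 2 ^ d.-1)%N.
  have := card_perp_dim U; rewrite dimU.
  have -> : (2 * d = 2 + d.-1 + d.-1)%N by lia.
  by rewrite !expnD => /eqP; rewrite eqn_pmul2r ?expn_gt0 // => /eqP.
have th1 v : v \in perp U -> v \notin U -> theta v = 1.
  move=> vP vU; apply/eqP; rewrite -neq0_F2; apply/negP => /eqP thv.
  have /OmegaP thD := th.
  suff tsW : totally_singular theta (U + <[v]>)%VS.
    have := witt_index_max tsW; rewrite wt -dimU => le_dim.
    have /geq_leqif := dimv_leqif_sup (addvSl U <[v]>%VS).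
    rewrite le_dim => /esym/subvP/(_ v) vU'; case/negP: vU; apply: vU'.
    exact: subvP (addvSr U <[v]>%VS) _ (memv_line v).
  apply/'forall_implyP => _ /memv_addP[u uU [_ /vlineP[k ->] ->]].
  move: vP; rewrite inE => /'forall_in_eqP/(_ u uU) buv.
  move/'forall_implyP: tsU => /(_ u uU)/eqP thu.
  rewrite thD thu bZr buv mulr0 addr0 add0r.
  by case: (F2_eq01 k) => ->; rewrite ?scale0r ?scale1r ?thv ?(Omega0 th).
rewrite (bigID (mem U)) /=.
rewrite (eq_bigr (fun=> 1)) => [|v /andP[_ vU]]; last first.
  by move/'forall_implyP: tsU => /(_ v vU)/eqP->.
rewrite [X in _ + X](eq_bigr (fun=> - 1)) => [|v /andP[vP vU]]; last first.
  by rewrite th1.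
rewrite sumrN !sumr_const.
have c1 : #|[pred v | (v \in perp U) && (v \in U)]| = (2 ^ d.-1)%N.
  by rewrite -cardU; apply: eq_card => v; rewrite inE andb_idl //; apply: subU.
have c2 : #|[pred v | (v \in perp U) && (v \notin U)]| = (3 * 2 ^ d.-1)%N.
  have := cardID (mem U) (mem (perp U)); rewrite cardP.
  rewrite (_ : #|[predI perp U & U]| = (2 ^ d.-1)%N); last first.
    by rewrite -c1; apply: eq_card => v; rewrite !inE.
  rewrite (_ : #|[predD perp U & U]| =
    #|[pred v | (v \in perp U) && (v \notin U)]|); first by lia.
  by apply: eq_card => v; rewrite !inE andbC.
rewrite c1 c2 -(prednK d_gt0) expnS /= !natrM; ring.
Qed.


(** * Translating forms by vectors *)

(** Riesz representation by counting: the sum over a and v of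
    (-1)^(l(v) + b(a, v)) is |V| by summing over a first, so that for some a the
    sum over v is nonzero, which forces l + b(a, -) to be zero. *)
Lemma linear_form_repr (l : fV -> 'F_2) : {morph l : u v / u + v} ->
  exists a, l =1 b a.
Proof.
move=> lD; have lbD a : {morph (fun v => l v + b a v) : u v / u + v}.
  by move=> u v; rewrite lD bDr addrACA.
case: (pickP (fun a => [forall v in {:fV}%VS, l v + b a v == 0])) => [a|no_a].
  move/'forall_in_eqP => la; exists a => v.
  by apply/eqP; rewrite -subr_eq0 oppF2 la ?memvf.
have : \sum_a \sum_(v in {:fV}%VS) chi (l v + b a v) = 0.
  by rewrite big1 // => a _; rewrite (sum_chi_linear _ (lbD a)) no_a.
rewrite exchange_big (bigD1 0) ?memvf //= [X in _ + X]big1 => [|v /andP[_ v0]].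
  rewrite addr0 (eq_bigr (fun=> 1)) => [|a _]; last first.
    have l0 : l 0 = 0 by have := lD 0 0; rewrite addr0 => ->; rewrite addF2.
    by rewrite l0 bC b0l.
  rewrite sumr_const => /eqP; rewrite pnatr_eq0 => /eqP/card0_eq/(_ 0).
  by rewrite inE.
rewrite (eq_bigr (fun a => chi (l v) * chi (b a v))) => [|a _].
  rewrite -mulr_sumr (eq_bigl (mem {:fV}%VS)) => [|a]; last by rewrite /= memvf.
  rewrite sum_chi_linear => [|u w]; last exact: bDl.
  case: ifP => [/'forall_in_eqP vb|]; last by rewrite mulr0.
  by case/eqP: v0; apply: b_nondeg => a; rewrite bC vb ?memvf.
exact: chiD.
Qed.

Definition shift theta a : {ffun fV -> 'F_2} := [ffun v => theta v + b a v].

Lemma shift_Omega theta a : theta \in Omega phi -> shift theta a \in Omega phi.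
Proof.
by move=> /OmegaP th; apply/OmegaP => u v; rewrite !ffunE th bDr; ring.
Qed.

Lemma shift_inj theta : injective (shift theta).
Proof.
move=> a c /ffunP eq_ac; apply/eqP; rewrite -subr_eq0; apply/eqP/b_nondeg => v.
have := eq_ac v; rewrite !ffunE => /addrI eqb.
by rewrite bDl -scaleN1r bZl -eqb mulN1r oppF2 addF2.
Qed.

Lemma shift_onto theta theta' : theta \in Omega phi -> theta' \in Omega phi ->
  exists a, theta' = shift theta a.
Proof.
move=> /OmegaP th /OmegaP th'.
have [|a la] := @linear_form_repr (fun v => theta' v - theta v).
  by move=> u v; rewrite th th'; ring.
by exists a; apply/ffunP => v; rewrite ffunE -la addrC subrK.
Qed.

Lemma shift0 theta : shift theta 0 = theta.
Proof. by apply/ffunP => v; rewrite ffunE b0l addr0. Qed.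

(** Since theta(v) + b(a, v) = theta(v + a) + theta(a). *)
Lemma gauss_shift theta a : theta \in Omega phi ->
  gauss (shift theta a) = chi (theta a) * gauss theta.
Proof.
move=> /OmegaP th; rewrite /gauss mulr_sumr [in RHS](reindex_inj (addIr a)) /=.
apply: eq_bigr => v _; rewrite -chiD ffunE th bC; congr chi.
by rewrite -[LHS]addr0 -(addF2 (theta a)); ring.
Qed.

(** The transvection t(v) = v + b(v, a) a is an involution and, as theta(a) = 0,
    it satisfies theta(t v) = theta(v) + b(a, v). It therefore maps totally
    singular subspaces of theta to totally singular subspaces of the shifted
    form, without changing their dimension. *)
Lemma witt_index_shift_ge theta a : theta \in Omega phi -> theta a = 0 ->
  (witt_index theta <= witt_index (shift theta a))%N.
Proof.
move=> thO tha; have [U tsU <-] := witt_index_attained thO.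
move: thO => /OmegaP th.
pose t v : fV := v + b v a *: a.
have t_lin : linear t.
  by move=> k u v; rewrite /t bDl bZl scalerDl scalerDr scalerA addrACA.
pose tL := GRing.isLinear.Build _ _ _ _ t t_lin.
pose T : {linear fV -> fV} := HB.pack t tL.
have TT : cancel t t.
  move=> v; rewrite /t bDl bZl buu mulr0 addr0 -addrA -scalerDl addF2.
  by rewrite scale0r addr0.
have kerT : lker (linfun T) = 0%VS.
  apply/eqP/lker0P => u v; rewrite !lfunE /= => /(can_inj TT)//.
rewrite -(limg_dim_eq (f := linfun T)) ?kerT ?capv0 //.
apply: witt_index_max; apply/'forall_implyP => _ /memv_imgP[u uU ->].
rewrite lfunE ffunE /= /t th bDr !bZr buu mulr0 addr0.
move/'forall_implyP: tsU => /(_ u uU)/eqP ->.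
rewrite [b a u]bC; case: (F2_eq01 (b u a)) => ->.
  by rewrite scale0r (polarizes0 th) mul0r !addr0.
by rewrite scale1r tha mul1r add0r add0r addF2.
Qed.

Lemma witt_index_shift theta a : theta \in Omega phi -> theta a = 0 ->
  witt_index (shift theta a) = witt_index theta.
Proof.
move=> th tha; apply/eqP; rewrite eqn_leq witt_index_shift_ge // andbT.
have {2}-> : theta = shift (shift theta a) a.
  by apply/ffunP => v; rewrite !ffunE -addrA addF2 addr0.
by apply: witt_index_shift_ge; rewrite ?shift_Omega // ffunE tha buu addr0.
Qed.

Section WittClass.

Variable w : nat.
Hypotheses (d_gt1 : (1 < d)%N) (w_cases : w = d \/ w = d.-1).
Let X := [set theta in Omega phi | witt_index theta == w].

Lemma gauss_witt_class theta : theta \in X ->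
  gauss theta = if w == d then (2 ^ d)%:R else - (2 ^ d)%:R.
Proof.
case/setIdP=> th /eqP wt; have [U tsU dimU] := witt_index_attained th.
rewrite wt in dimU; case: eqP => [wd|/eqP wd].
  by apply: gauss_dim_d tsU _ => //; rewrite dimU.
case: w_cases => [wd'|w_pred]; first by rewrite wd' eqxx in wd.
by apply: (gauss_dim_pred _ th tsU); rewrite ?dimU ?wt // (ltnW d_gt1).
Qed.

(** The sign of the Gauss sum is constant on X and detects theta(a). *)
Lemma shift_witt_class theta a :
  theta \in X -> (shift theta a \in X) = (theta a == 0).
Proof.
move=> thX; have /setIdP[th /eqP wt] := thX.
apply/idP/eqP => [thaX|tha]; last first.
  by rewrite inE shift_Omega // witt_index_shift // wt eqxx.
have := gauss_witt_class thaX.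
rewrite gauss_shift // (gauss_witt_class thX).
case: (F2_eq01 (theta a)) => -> //.
have : (2 ^ d)%:R != 0 :> int by rewrite pnatr_eq0 expn_eq0.
by rewrite /chi oner_eq0 mulN1r; move: (_%:R) => c; case: ifP => _; lia.
Qed.

(** X has as many elements as theta has zeros, and this number m satisfies
    2 m = 2^(2d) + 2^d or 2^(2d) - 2^d by the value of the Gauss sum; so m is
    even as soon as d > 1. *)
Lemma even_card_witt_class theta : theta \in X -> ~~ odd #|X|.
Proof.
move=> thX; have /setIdP[th _] := thX.
have -> : #|X| = #|[pred a | theta a == 0]|.
  rewrite -(card_imset _ (@shift_inj theta)); apply: eq_card => theta'.
  apply/idP/imsetP => [th'X|[a]]; last first.
    by rewrite inE -(shift_witt_class _ thX) => ? ->.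
  have /setIdP[th' _] := th'X.
  have [a def_th'] := shift_onto th th'; exists a => //.
  by rewrite inE -(shift_witt_class _ thX) -def_th'.
have := gauss_witt_class thX; rewrite /gauss (bigID (fun v => theta v == 0)) /=.
rewrite (eq_bigr (fun=> 1)) => [|v /eqP->] //.
rewrite [X in _ + X](eq_bigr (fun=> - 1)) => [|v /negPf]; last first.
  by rewrite /chi => ->.
rewrite sumrN !sumr_const.
have := cardC [pred a | theta a == 0]; rewrite card_fV.
rewrite -[#|[predC _]|]/(#|[pred a | theta a != 0]|).
move: #|_| #|_| => m n.
have -> : (2 * d = d.-2 + d.-2 + 4)%N by lia.
have -> : (d = d.-2 + 2)%N by lia.
rewrite !expnD; move: (2 ^ d.-2)%N => k.
by case: ifP => _; lia.
Qed.

End WittClass.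
End Dimension.

(** * Symplectic bases *)

Local Notation pairs := (seq (fV * fV)).
Local Notation symplectic := (symplectic_seq b).

Lemma orth_span (X : seq fV) u :
  {in X, forall w, b u w = 0} -> {in <<X>>%VS, forall w, b u w = 0}.
Proof.
elim: X => [|x X IHX] uX w.
  by rewrite span_nil memv0 => /eqP->; rewrite bC b0l.
rewrite span_cons => /memv_addP[_ /vlineP[k ->] [y yX ->]].
rewrite bDr bZr uX ?mem_head // mulr0 add0r IHX // => z zX.
by rewrite uX // inE zX orbT.
Qed.

Lemma symplectic_cons p (s : pairs) : symplectic (p :: s) =
  [&& b p.1 p.2 == 1, all (orth_pair b p) s & symplectic s].
Proof.
by rewrite /symplectic_seq /= -!andbA; congr (_ && _); rewrite andbCA.
Qed.

Lemma orth_pair_seq p (s : pairs) : all (orth_pair b p) s ->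
  {in pair_seq s, forall w, b p.1 w = 0 /\ b p.2 w = 0}.
Proof.
move=> /allP os w /mem_pair_seq[q qs qw].
by have := orth_pairP bC (os q qs); case: qw => -> [] h; rewrite !h.
Qed.

Lemma std_polar_eq0 (s : pairs) u x :
  {in pair_seq s, forall w, b x w = 0} -> std_polar b s u x = 0.
Proof.
move=> xs; rewrite /std_polar big_seq big1 // => q qs.
by rewrite /hyp_polar !xs ?mulr0 ?addr0 //; apply/mem_pair_seq; exists q; tauto.
Qed.

Lemma std_polarC (s : pairs) u v : std_polar b s u v = std_polar b s v u.
Proof. by apply: eq_bigr => p _; rewrite /hyp_polar; ring. Qed.

Lemma std_polar_pair_seq (s : pairs) u : symplectic s ->
  {in pair_seq s, forall w, std_polar b s u w = b u w}.
Proof.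
elim: s => // p s IHs; rewrite symplectic_cons => /and3P[/eqP hp op ss] w.
have po := orth_pair_seq op.
rewrite /std_polar big_cons -/(std_polar b s u w) /hyp_polar.
rewrite !inE => /or3P[/eqP->|/eqP->|ws].
- rewrite std_polar_eq0 => [|w' /po[]//].
  by rewrite buu hp mulr0 mulr1 !addr0.
- rewrite std_polar_eq0 => [|w' /po[]//].
  by rewrite buu [b p.2 _]bC hp mulr0 mulr1 addr0 add0r.
have [w1 w2] := po w ws.
  by rewrite [b w p.1]bC [b w p.2]bC w1 w2 !mulr0 !add0r IHs.
Qed.

Lemma free_pair_seq (s : pairs) : symplectic s -> free (pair_seq s).
Proof.
elim: s => [|p s IHs]; first by rewrite nil_free.
rewrite symplectic_cons => /and3P[/eqP hp op /IHs free_s].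
have po := orth_pair_seq op.
rewrite /pair_seq /= -/(pair_seq s) !free_cons free_s andbT.
apply/andP; split; apply/negP => ps.
  have /eqP : b p.2 p.1 = 0.
    apply: orth_span ps => w; rewrite inE => /predU1P[->|/po[]//].
    exact: buu.
  by rewrite bC hp oner_eq0.
have /eqP : b p.1 p.2 = 0 by apply: orth_span ps => w /po[].
by rewrite hp oner_eq0.
Qed.

(** If the form of s differs from b at (x, y), removing from x and y their
    projections on the span of s leaves a hyperbolic pair orthogonal to s. *)
Lemma symplectic_extend (s : pairs) : symplectic s ->
  std_polar b s =2 b \/ exists p, symplectic (p :: s).
Proof.
move=> ss.
case: (pickP (fun xy : fV * fV => std_polar b s xy.1 xy.2 != b xy.1 xy.2)).
  case=> x y /= neq; right.
  pose pr v := v + \sum_(p <- s) (b v p.2 *: p.1 + b v p.1 *: p.2).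
  have prE v w : b (pr v) w = b v w + std_polar b s v w.
    rewrite bDl; congr (_ + _); rewrite /std_polar.
    elim: s {ss neq pr} => [|p s IHs]; first by rewrite !big_nil b0l.
    by rewrite !big_cons !bDl !bZl IHs /hyp_polar [b w p.1]bC [b w p.2]bC; ring.
  have pr0 v : {in pair_seq s, forall w, b (pr v) w = 0}.
    by move=> w ws; rewrite prE std_polar_pair_seq // addF2.
  exists (pr x, pr y); rewrite symplectic_cons ss andbT /=; apply/andP; split.
    rewrite prE std_polar_eq0 ?addr0; last exact: pr0.
    by rewrite bC prE std_polarC bC -neq0_F2 addrC -[b x y]oppF2 subr_eq0.
  apply/allP => q qs; rewrite /orth_pair /= !pr0 ?eqxx //;
    by apply/mem_pair_seq; exists q; tauto.
by move=> eq_b; left=> x y; apply/eqP; have := eq_b (x, y); case: eqP.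
Qed.

(** A symplectic sequence is free, which bounds its size by d; when it cannot be
    extended it spans V, which makes its size exactly d. *)
Lemma symplectic_basis_exists d : \dim {:V} = (2 * d)%N ->
  exists s : pairs, [/\ symplectic s, std_polar b s =2 b & size s = d].
Proof.
move=> dimV; have size_pair (s : pairs) : size (pair_seq s) = (2 * size s)%N.
  by elim: s => // p s IHs; rewrite /pair_seq /= -/(pair_seq s) IHs; lia.
have size_le (s : pairs) : symplectic s -> (size s <= d)%N.
  move=> /free_pair_seq/eqP dim_s; have := dimvS (subvf <<pair_seq s>>).
  by rewrite dim_s size_pair -[\dim {:fV}]/(\dim {:V}) dimV leq_pmul2l.
suff [s [ss sb]] : exists s : pairs, symplectic s /\ std_polar b s =2 b.
  exists s; split=> //; apply/eqP; rewrite eqn_leq size_le //=.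
  rewrite -(leq_pmul2l (isT : 0 < 2)%N) -dimV -size_pair.
  apply: leq_trans (dim_span _); rewrite -[\dim {:V}]/(\dim {:fV}).
  apply/dimvS/subvP => v _.
  suff -> : v = \sum_(p <- s) (b v p.2 *: p.1 + b v p.1 *: p.2).
    rewrite big_seq; apply: memv_suml => p ps.
    by rewrite memvD ?memvZ ?memv_span //; apply/mem_pair_seq; exists p; tauto.
  apply/eqP; rewrite -subr_eq0; apply/eqP/b_nondeg => w.
  rewrite bDl -scaleN1r bZl mulN1r oppF2 -{1}sb /std_polar.
  elim: s {ss sb} => [|p s IHs]; first by rewrite !big_nil b0l addr0.
  rewrite !big_cons bDl addrACA IHs addr0 bDl !bZl /hyp_polar.
  by rewrite !(bC w) [X in _ + X]addrC addF2.
have [n le_n] : exists n, (d - size ([::] : pairs) < n)%N by exists d.+1; lia.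
have : symplectic ([::] : pairs) by [].
elim: n [::] le_n => // n IHn s le_n ss.
have [sb|[p ps]] := symplectic_extend ss; first by exists s.
have := size_le _ ps; rewrite /= in le_n * => size_ps.
by apply: (IHn (p :: s)) => //=; lia.
Qed.

(** * Both Witt indices occur *)

Lemma fst_isotropic (s : pairs) : symplectic s ->
  {in [seq p.1 | p <- s] &, forall x y, b x y = 0}.
Proof.
elim: s => // p s IHs; rewrite symplectic_cons => /and3P[_ op /IHs iso].
have po x : x \in [seq q.1 | q <- s] -> b p.1 x = 0.
  case/mapP=> q qs ->; have /(_ q.1)[] // := orth_pair_seq op.
  by apply/mem_pair_seq; exists q; tauto.
move=> x y /= /predU1P[->|xs] /predU1P[->|ys].
- exact: buu.
- exact: po.
- by rewrite bC po.
- exact: iso.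
Qed.

Lemma free_fst (s : pairs) : symplectic s -> free [seq p.1 | p <- s].
Proof.
elim: s => [|p s IHs]; first by rewrite nil_free.
rewrite symplectic_cons => /and3P[/eqP hp op /IHs free_s] /=.
rewrite free_cons free_s andbT; apply/negP => ps.
have /eqP : b p.2 p.1 = 0.
  apply: orth_span ps => _ /mapP[q qs ->].
  have /(_ q.1)[] // := orth_pair_seq op.
  by apply/mem_pair_seq; exists q; tauto.
by rewrite bC hp oner_eq0.
Qed.

Lemma totally_singular_span theta (X : seq fV) : theta \in Omega phi ->
    {in X, forall x, theta x = 0} -> {in X &, forall x y, b x y = 0} ->
  totally_singular theta <<X>>.
Proof.
move=> thO thX bX; apply/'forall_implyP => v vX; apply/eqP.
have /OmegaP th := thO.
elim: X thX bX v vX => [|x X IHX] thX bX v.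
  by rewrite span_nil memv0 => /eqP->; apply: Omega0.
rewrite span_cons => /memv_addP[_ /vlineP[k ->] [y yX ->]].
have bxX : {in X, forall z, b x z = 0}.
  by move=> z zX; rewrite bX ?mem_head // inE zX orbT.
rewrite th bZl (orth_span bxX yX) mulr0 addr0 (IHX _ _ y) //.
- case: (F2_eq01 k) => ->; rewrite ?scale0r ?scale1r addr0 ?Omega0 //.
  exact/thX/mem_head.
- by move=> z zX; rewrite thX // inE zX orbT.
- by move=> z z' zX z'X; rewrite bX // inE ?zX ?z'X orbT.
Qed.

Lemma std_form_head_eq0 p (s : pairs) : symplectic (p :: s) ->
  std_form b (p :: s) p.1 = 0 /\ std_form b (p :: s) p.2 = 0.
Proof.
rewrite symplectic_cons => /and3P[_ op _]; have po := orth_pair_seq op.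
rewrite /std_form !big_cons -!/(std_form b s _) /hyp_form !buu mul0r mulr0.
by split; rewrite std_form_eq0 ?addr0 // => w /po[].
Qed.

Lemma std_form_isotropic (s : pairs) x : symplectic s ->
  x \in [seq p.1 | p <- s] -> std_form b s x = 0.
Proof.
move=> ss xs; rewrite /std_form big_seq big1 // => p ps.
by rewrite /hyp_form (fst_isotropic ss) ?mul0r //; apply: map_f.
Qed.

(** The standard form is totally singular on the span of the e_i, hence of Witt
    index d. Translating it by c = e_1 + f_1, on which it takes the value 1,
    changes the sign of its Gauss sum and so lowers the index; the result is
    still totally singular on the span of the e_i with i > 1. *)
Lemma witt_class_nonempty d m : (0 < d)%N -> \dim {:V} = (2 * d)%N ->
    m = d \/ m = d.-1 ->
  exists theta, theta \in [set theta in Omega phi | witt_index theta == m].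
Proof.
move=> d_gt0 dimV m_cases.
have [[|p s]] := symplectic_basis_exists dimV; case=> ss sb sz.
  by rewrite -sz in d_gt0.
pose th := [ffun v => std_form b (p :: s) v] : {ffun fV -> 'F_2}.
have thO : th \in Omega phi.
  by apply/OmegaP => u v; rewrite !ffunE (std_form_polarizes bDl) sb.
have dim_fst (s' : pairs) :
    symplectic s' -> \dim <<[seq q.1 | q <- s']>> = size s'.
  by move=> /free_fst/eqP->; rewrite size_map.
have tsE : totally_singular th <<[seq q.1 | q <- p :: s]>>.
  apply: totally_singular_span => //; last exact: fst_isotropic.
  by move=> x xs; rewrite ffunE std_form_isotropic.
have witt_le theta : theta \in Omega phi -> (witt_index theta <= d)%N.
  by move=> /[dup] thetaO /witt_index_attained[U tsU <-];
    apply: (dim_totally_singular dimV thetaO).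
case: m_cases => ->.
  exists th; apply/setIdP; split=> //; rewrite eqn_leq witt_le //=.
  by have := witt_index_max tsE; rewrite dim_fst // sz.
pose c := p.1 + p.2; have [th1 th2] := std_form_head_eq0 ss.
have /[!symplectic_cons]/and3P[/eqP hp op ss'] := ss.
have thc : th c = 1.
  by rewrite ffunE (std_form_polarizes bDl) sb th1 th2 hp !add0r.
have shO : shift th c \in Omega phi by apply: shift_Omega.
have gauss_c : gauss (shift th c) = - (2 ^ d)%:R.
  rewrite gauss_shift // thc (gauss_dim_d dimV thO tsE) ?dim_fst //.
  by rewrite /chi oner_eq0 mulN1r.
have tsE' : totally_singular (shift th c) <<[seq q.1 | q <- s]>>.
  apply: totally_singular_span => //; last exact: fst_isotropic.
  move=> x xs; rewrite !ffunE std_form_isotropic //=; last first.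
    by rewrite inE xs orbT.
  case/mapP: xs => q qs ->; have [|h1 h2] := orth_pair_seq op (x := q.1).
    by apply/mem_pair_seq; exists q; tauto.
  by rewrite bDl h1 h2 !addr0.
exists (shift th c); apply/setIdP; split=> //.
have := witt_index_max tsE'; rewrite dim_fst // => ge_w.
have := witt_le _ shO; rewrite leq_eqVlt => /orP[/eqP wd|]; last first.
  by rewrite /= in sz; rewrite eqn_leq; lia.
have [U tsU dimU] := witt_index_attained shO; rewrite wd in dimU.
have := gauss_dim_d dimV shO tsU dimU; rewrite gauss_c.
have : (2 ^ d)%:R != 0 :> int by rewrite pnatr_eq0 expn_eq0.
by move: (_%:R) => k; lia.
Qed.

(** * The double count *)

(** The count needs a form theta in X to start from; indeed every set of
    permutations of an empty X would be sharply 2-transitive. *)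
Lemma no_sharply_2transitive_witt_class d m
    (X := [set theta in Omega phi | witt_index theta == m])
    (S : {set {perm {theta | theta \in X}}}) :
    (3 < d)%N -> \dim {:V} = (2 * d)%N -> m = d \/ m = d.-1 ->
  S \subset Sp_on phi X -> ~ sharply_2transitive S.
Proof.
move=> d_gt3 dimV m_cases subS trS.
have d_gt1 : (1 < d)%N by lia.
have [theta thX] : exists theta, theta \in X.
  by apply: witt_class_nonempty dimV m_cases; lia.
have /setIdP[thO _] := thX; have /OmegaP th := thO.
have shX a : (shift theta a \in X) = (theta a == 0).
  exact: (shift_witt_class dimV d_gt1 m_cases a thX).
have evenX := even_card_witt_class dimV d_gt1 m_cases thX.
have [[|p1 [|p2 [|p3 [|p4 s]]]]] := symplectic_basis_exists dimV;
  case=> ss sb sz; rewrite /= in sz; try by [move: d_gt3; rewrite -sz].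
pose ps := [:: p1, p2, p3, p4 & s].
pose A := cube p4.1 (pair_seq [:: p1; p2; p3]).
pose x0 : {theta | theta \in X} := exist _ theta thX.
(* A junk value when v is not singular, where the factor 1 + theta v is 0. *)
pose x v := insubd x0 (shift theta v).
(* The quartic function transported to X along a |-> theta + b a; the sum has
   exactly one term. *)
pose K (y : {theta | theta \in X}) :=
  \sum_(a | val y == shift theta a) std_quartic b ps a.
have KE y a : val y = shift theta a -> K y = std_quartic b ps a.
  move=> ya; rewrite /K (big_pred1 a) // => c; rewrite ya.
  by rewrite (inj_eq (@shift_inj _)) eq_sym.
have xE v : theta v = 0 -> val (x v) = shift theta v.
  by move=> tv; rewrite val_insubd shX tv eqxx.
have x_neq v : v \in A -> theta v = 0 -> x v != x0.
  move=> vA tv; rewrite -val_eqE /= xE // -[X in _ != X](shift0 theta).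
  rewrite (inj_eq (@shift_inj _)); apply/eqP => v0.
  have := cube_pairing_last bDl bC ss vA; rewrite v0 b0l => /eqP.
  by rewrite eq_sym oner_eq0.
have inner (g : {perm {theta | theta \in X}}) : g \in S -> g x0 = x0 ->
    \sum_(v <- A) (1 + theta v) * K (g (x v)) = 1.
  move=> /(subsetP subS); rewrite inE => /exists_inP[f].
  rewrite inE => /andP[/'forall_'forall_'forall_eqP f_lin].
  move=> /'forall_'forall_eqP f_phi.
  move=> /forallP gf g0.
  have fD : {morph f : u v / u + v}.
    by move=> u v; have := f_lin 1 u v; rewrite !scale1r.
  rewrite -[RHS](isometry_count bDl bC buu ss sb th fD f_phi).
  apply: eq_bigr => v _; case: (F2_eq01 (theta v)) => tv.
    congr (_ * _); apply: KE; apply/ffunP => u.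
    have := gf (x v); rewrite (xE v tv) => /eqP->.
    have /eqP/ffunP/(_ u) := gf x0; rewrite g0 !ffunE /= => ->.
    by rewrite /b -f_phi permKV.
  by rewrite tv addF2 !mul0r.
have oddS : \sum_(g in S | g x0 == x0) (1 : 'F_2) = 1.
  have cardX : ~~ odd #|{: {theta | theta \in X}}| by rewrite card_sig.
  have [x1 x1N] : exists x1, x1 != x0.
    case: (pickP (fun y => y != x0)) => [y|all0]; first by exists y.
    move: cardX; rewrite (eq_card1 (x := x0)) // => y.
    by rewrite !inE; have /negbFE := all0 y.
  rewrite (sum_sharply_2transitive (fun=> 1) trS x1N).
  have : \sum_(y : {theta | theta \in X}) (1 : 'F_2) = 0.
    rewrite sumr_const; apply/eqP; rewrite -(dvdn_pcharf (pchar_Fp _)) //.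
    by rewrite dvdn2.
  by rewrite (bigD1 x0) //= => /eqP; rewrite addrC addr_eq0 oppF2 => /eqP.
have : \sum_(g in S | g x0 == x0) \sum_(v <- A) (1 + theta v) * K (g (x v)) = 1.
  by rewrite -[RHS]oddS; apply: eq_bigr => g /andP[gS /eqP g0]; apply: inner.
rewrite exchange_big /= big_seq.
rewrite (eq_bigr (fun v => (1 + theta v) * \sum_(y | y != x0) K y)) => [|v vA].
  rewrite -big_seq -mulr_suml (even_count bDl _ _ _ _ th) mul0r => /eqP.
  by rewrite eq_sym oner_eq0.
rewrite -mulr_sumr; case: (F2_eq01 (theta v)) => tv.
  by rewrite (sum_sharply_2transitive _ trS) // x_neq.
by rewrite tv addF2 !mul0r.
Qed.

End SymplecticSpace.

Theorem corollary5 (d : nat) (V : vectType 'F_2) (phi : {skew_symmetric V})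
    (hd : (4 <= d)%N) (hV : \dim {:V} = (2 * d)%N) (hphi : is_psymplectic phi) :
  (forall S : {set {perm {theta | theta \in Omega_plus d phi}}},
     S \subset Sp_on phi (Omega_plus d phi) -> ~ sharply_2transitive S) /\
  (forall S : {set {perm {theta | theta \in Omega_minus d phi}}},
     S \subset Sp_on phi (Omega_minus d phi) -> ~ sharply_2transitive S).
Proof.
split=> S; apply: no_sharply_2transitive_witt_class hphi _ _ _ hd hV _.
  by left.
by right.
Qed.
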